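(* Let $k\ge 3$, $n>3$, and let $f\in P_k^n$ depend essentially on all of its $n$ variables. Then the following are equivalent: (i) $f\in G_{2,k}^{n,+}$; (ii) there exist $n-2$ variables $y_{l_1},\ldots,y_{l_{n-2}}\in\{x_1,\ldots,x_n\}$ such that $f=h\oplus g$, where $h\in P_k^n$ satisfies $Ess(h)=\{y_{l_1},\ldots,y_{l_{n-2}}\}$, $g\in G_{n,k}^n$, and moreover $g_{i\leftarrow j}=0$ for all $1\le i,j\le n$ with $i\neq j$.
   Context: $K=\{0,1,\ldots,k-1\}$ is the ring of residues modulo $k$, $\oplus$ is pointwise addition modulo $k$. $P_k^n$ is the set of all functions $K^n\to K$ in variables $x_1,\ldots,x_n$. A variable $x_i$ is essential in $g$ if changing only the $i$-th argument can change the value of $g$; $Ess(g)$ is the set of essential variables, $ess(g)=|Ess(g)|$. For $i\neq j$, $g_{i\leftarrow j}(a_1,\ldots,a_n)=g(a_1,\ldots,a_{i-1},a_j,a_{i+1},\ldots,a_n)$. $Min(g)$ is the set of all $g_{i\leftarrow j}$ with $i\neq j$ and $x_i,x_j\in Ess(g)$; $gap(g)=ess(g)-\max_{t\in Min(g)}ess(t)$. $G_{p,k}^m=\{f\in P_k^n: ess(f)=m,\ gap(f)=p\}$. $G_{p,k}^{n,+}$ is the set of $f\in G_{p,k}^n$ for which there exist $i\neq j$ with $x_j\in Ess(f_{i\leftarrow j})$ and $ess(f_{i\leftarrow j})=n-p$. *)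

(* Defs.v *)
From mathcomp Require Import all_boot all_order all_algebra.

Set Implicit Arguments.
Unset Strict Implicit.
Unset Printing Implicit Defensive.

Local Open Scope ring_scope.

(* 'Z_k is the ring of residues modulo k only for k >= 2.  The variables
   x_1, ..., x_n are indexed from 0 by 'I_n.  For finite functions Leibniz
   equality is extensional, and the canonical addition of this type is
   pointwise addition modulo k. *)
Notation Pkn k n := {ffun {ffun 'I_n -> 'Z_k} -> 'Z_k}.

Section EssentialArityGap.

Variables k n : nat.
Implicit Types (g f : Pkn k n) (a : {ffun 'I_n -> 'Z_k}) (i j : 'I_n).

Definition update a i (c : 'Z_k) : {ffun 'I_n -> 'Z_k} :=
  [ffun l => if l == i then c else a l].

Definition essential g i : bool :=
  [exists a : {ffun 'I_n -> 'Z_k}, exists c : 'Z_k, g (update a i c) != g a].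

Definition Ess g : {set 'I_n} := [set i | essential g i].

Definition ess g : nat := #|Ess g|.

Definition identify g i j : Pkn k n := [ffun a => g (update a i (a j))].

Definition Min g : {set Pkn k n} :=
  [set identify g i j | i in Ess g, j in Ess g & i != j].

(* The truncation of the subtraction is harmless, since identifying variables
   never increases ess.  When ess g < 2, Min g is empty and the maximum is 0. *)
Definition gap g : nat := (ess g - \max_(t in Min g) ess t)%N.

Definition G (p m : nat) : {set Pkn k n} :=
  [set f | (ess f == m) && (gap f == p)].

Definition Gplus (p : nat) : {set Pkn k n} :=
  [set f in G p n | [exists i : 'I_n, exists j : 'I_n,
    [&& i != j, j \in Ess (identify f i j) & ess (identify f i j) == (n - p)%N]]].

End EssentialArityGap.

Arguments G k n p m : clear implicits.
Arguments Gplus k n p : clear implicits.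

(* Main.v *)
Require Import Defs.
From mathcomp Require Import all_boot all_order all_algebra.
From mathcomp Require Import perm.

Set Implicit Arguments.
Unset Strict Implicit.
Unset Printing Implicit Defensive.

Import GRing.Theory.

Local Open Scope ring_scope.

(* Both implications concern the restriction of [f] to the tuples with a
   repeated entry: (ii) says that there [f] agrees with some [h] having exactly
   [n - 2] essential variables.

   For (i) => (ii), gap 2 means that whenever two variables are identified, at
   least one further variable is lost.  Let [h] be the given minor
   [f_{i<-j}], whose essential variables are all but [x_i] and some [x_m].
   Writing [f(x_i, x_j, x_m, ...)], the minors [f(x, y, x, ...)] and
   [f(y, x, x, ...)] both extend [f(x, x, x, ...) = h(x, ...)], so each of them
   is [h(x, ...)] or [h(y, ...)].  The two "majority" and "minority" patterns
   are refuted by identifying [x_i] with a fourth variable: every variable that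
   could be lost would be inessential in [h].  In the two remaining patterns
   [f] is [h], read in [x_j] or in [x_i], as soon as two of [x_i, x_j, x_m]
   coincide, and this agreement propagates to every other pair by the same kind
   of argument. *)

Ltac pointwise := rewrite /update ?ffunE;
  repeat (case: eqP => //; intros); simpl in *; try subst; congruence.

(** * Essential variables, minors, and the pointwise form of gap 2 *)

Section Essential.

Variables k n : nat.
Implicit Types (f g h : Pkn k n) (a b : {ffun 'I_n -> 'Z_k}) (i j l : 'I_n).

Lemma essentialPn g i :
  reflect (forall a b, (forall l, l <> i -> a l = b l) -> g a = g b)
          (i \notin Ess g).
Proof.
rewrite inE; apply: (iffP existsPn) => [H a b ab | H a].
  have /existsPn /(_ (b i)) := H a; rewrite negbK => /eqP <-.
  by congr (g _); apply/ffunP => l; rewrite ffunE; case: eqP => [->|/ab].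
apply/existsPn => c; rewrite negbK; apply/eqP; apply: H => l /eqP/negPf li.
by rewrite ffunE li.
Qed.

Lemma inessential_of_identify h i j : i <> j ->
  (forall a, h a = h (update a i (a j))) -> i \notin Ess h.
Proof.
move=> ij H; apply/essentialPn => a b ab.
rewrite H [RHS]H; congr (h _); apply/ffunP => l; rewrite !ffunE.
by case: eqP => [_|/ab //]; apply: ab => ji; apply: ij.
Qed.

Lemma inessential2_eq h i j a b : i \notin Ess h -> j \notin Ess h ->
  (forall l, l <> i -> l <> j -> a l = b l) -> h a = h b.
Proof.
move=> /essentialPn hi /essentialPn hj ab.
rewrite (hi a (update a i (b i))); last by move=> l; pointwise.
by apply: hj => l lj; rewrite ffunE; case: eqP => [->|/ab]; last exact.
Qed.

Lemma identifyE g i j a : a i = a j -> identify g i j a = g a.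
Proof.
by move=> aij; rewrite ffunE; congr (g _); apply/ffunP => l; pointwise.
Qed.

Lemma identify_notin_Ess g i j : i != j -> i \notin Ess (identify g i j).
Proof.
move=> /eqP ij; apply/essentialPn => a b ab; rewrite !ffunE; congr (g _).
apply/ffunP => l; rewrite !ffunE; case: eqP => [_|/ab //].
by apply: ab => ji; apply: ij.
Qed.

Lemma identify_inessential g i j : i \notin Ess g -> identify g i j = g.
Proof.
move/essentialPn => gi; apply/ffunP => a; rewrite ffunE.
by apply: gi => l li; pointwise.
Qed.

(** When [i] is essential and [i != j], it leaves the essential set and only [j] can enter;
    otherwise the minor is [g] itself. *)
Lemma ess_identify_le g i j : (ess (identify g i j) <= ess g)%N.
Proof.
have [gi|gi] := boolP (i \in Ess g); last by rewrite identify_inessential.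
have [<-|ij] := eqVneq i j.
  suff -> : identify g i i = g by [].
  by apply/ffunP => a; rewrite identifyE.
suff sub : Ess (identify g i j) \subset j |: (Ess g :\ i).
  apply: leq_trans (subset_leq_card sub) _.
  rewrite cardsU1 /ess (cardsD1 i (Ess g)) gi leq_add2r.
  by case: (_ \notin _).
apply/subsetP => l; rewrite !inE -!/(essential _ _) => el.
have [//|lj] := eqVneq l j => /=.
have li : l != i.
  apply: contraTneq el => ->.
  by have := identify_notin_Ess g ij; rewrite inE.
rewrite li /=; apply: contraTT el => gl.
have /essentialPn gl' : l \notin Ess g by rewrite inE.
suff : l \notin Ess (identify g i j) by rewrite inE.
apply/essentialPn => a b ab; rewrite !ffunE; apply: gl' => m ml.
rewrite !ffunE; case: eqP => _; last exact: ab.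
by apply: ab => jl; rewrite jl eqxx in lj.
Qed.

(** The two minors of a pair differ only in which of the two variables carries the common value. *)
Lemma identify_tperm g i j a :
  identify g j i a = identify g i j [ffun l => a (tperm i j l)].
Proof.
rewrite !ffunE tpermR; congr (g _); apply/ffunP => l; rewrite !ffunE.
case: eqP => [->|/eqP lj]; first by case: eqP => // _; rewrite tpermR.
case: eqP => [-> //|/eqP li].
by rewrite tpermD // eq_sym.
Qed.

Lemma identify_swap_Ess g i j l :
  (l \in Ess (identify g j i)) = (tperm i j l \in Ess (identify g i j)).
Proof.
apply: negb_inj; apply/essentialPn/essentialPn => H a b ab.
  have E c : identify g i j c = identify g j i [ffun l => c (tperm i j l)].
    rewrite [RHS]identify_tperm; congr (identify g i j _).
    by apply/ffunP => m; rewrite !ffunE tpermK.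
  rewrite !E; apply: H => m ml; rewrite !ffunE; apply: ab.
  by move/perm_inj.
rewrite (identify_tperm g i j a) (identify_tperm g i j b).
apply: H => m ml; rewrite !ffunE; apply: ab => E.
by apply: ml; rewrite -E tpermK.
Qed.

Lemma identify_inMin g i j : Ess g = [set: 'I_n] -> i != j ->
  identify g i j \in Min g.
Proof.
move=> gT ij; have eT l : l \in Ess g by rewrite gT inE.
by apply/imset2P; exists i j; rewrite // inE eT.
Qed.

Lemma ess_identify_gap g p i j : Ess g = [set: 'I_n] -> gap g = p -> i != j ->
  (ess (identify g i j) <= n - p)%N.
Proof.
move=> gT gp ij.
have gn : ess g = n by rewrite /ess gT cardsT card_ord.
have le : (ess (identify g i j) <= \max_(t in Min g) ess t)%N.
  by apply: leq_bigmax_cond; exact: identify_inMin.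
(* The subtraction in [gap] is truncated, so this bound is needed to recover the maximum as
   [n - p]. *)
have mle : (\max_(t in Min g) ess t <= n)%N.
  apply/bigmax_leqP => t /imset2P [u v _ _ ->].
  by rewrite -[X in (_ <= X)%N]gn ess_identify_le.
by move: gp; rewrite /gap gn => <-; rewrite subKn.
Qed.

(** The minor loses [i] and at least one more variable [t]. The case [t = j] can occur; entries [i]
    and [j] then change together, which is why [a] and [b] may also differ at [i]. *)
Lemma identify_loses g i j : (1 < n)%N -> Ess g = [set: 'I_n] -> gap g = 2%N ->
  i <> j ->
  exists2 t, t <> i & forall a b, a i = a j -> b i = b j ->
    (forall l, l <> t -> l <> i -> a l = b l) -> g a = g b.
Proof.
move=> n1 gT g2 /eqP ij.
have le := ess_identify_gap gT g2 ij.
have : (1 < #|~: Ess (identify g i j)|)%N.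
  rewrite cardsCs setCK card_ord ltn_subRL addn1.
  by move: le; rewrite leq_subRL.
rewrite (cardsD1 i) inE identify_notin_Ess //= add1n ltnS card_gt0.
case/set0Pn => t; rewrite !inE => /andP [/eqP ti te]; exists t => // a b aij bij ab.
rewrite -(identifyE g aij) -(identifyE g bij).
apply: (inessential2_eq (i := t) (j := i)) => //; first by rewrite inE.
exact: identify_notin_Ess.
Qed.

(** A function with an inessential variable is its own minor at that variable, hence would be 0. *)
Lemma vanishing_Ess g : (1 < n)%N -> (forall i j, i != j -> identify g i j = 0) ->
  g != 0 -> Ess g = [set: 'I_n].
Proof.
move=> n1 g0 gn0; apply/setP => i; rewrite [RHS]inE.
have [j ij] : exists j, i != j.
  have : (0 < #|[set~ i]|)%N by rewrite cardsC1 card_ord -subn1 subn_gt0.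
  by case/card_gt0P => j; rewrite !inE eq_sym; exists j.
apply: contra_neqT gn0 => gi.
by rewrite -(identify_inessential j gi) g0.
Qed.

Lemma ess0 : ess (0 : Pkn k n) = 0%N.
Proof.
apply/eqP; rewrite cards_eq0; apply/eqP/setP => i; rewrite [RHS]inE.
by apply/negbTE/essentialPn => a b _; rewrite !ffunE.
Qed.

Lemma vanishing_inG g : (forall i j, i != j -> identify g i j = 0) ->
  Ess g = [set: 'I_n] -> g \in G k n n n.
Proof.
move=> g0 gT; have gn : ess g = n by rewrite /ess gT cardsT card_ord.
rewrite inE /gap gn eqxx /=.
rewrite big1 ?subn0 // => t /imset2P [i j _]; rewrite inE => /andP [_ ij] ->.
by rewrite g0 // ess0.
Qed.

End Essential.

(** * Agreement of [f] with a function having two inessential variables *)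

Section Decomposition.

Variables (k n : nat) (f : Pkn k n).
Implicit Types (a b : {ffun 'I_n -> 'Z_k}) (h : Pkn k n).
Hypothesis loses : forall i j : 'I_n, i <> j ->
  exists2 t, t <> i & forall a b, a i = a j -> b i = b j ->
    (forall l, l <> t -> l <> i -> a l = b l) -> f a = f b.

(** If identifying [v] with [l] loses [w], that entry can be set to [a u], where agreement is known.
    Any other lost [t] would be inessential in [h], although [h] ignores only [v] and [w]. *)
Lemma agree_pair h (u v w l : 'I_n) :
  u <> v -> u <> w -> v <> w -> l <> u -> l <> v -> l <> w ->
  Ess h = ~: [set v; w] ->
  (forall a, a u = a w -> f a = h a) ->
  (forall a, a v = a w -> f a = h a) ->
  forall a, a v = a l -> f a = h a.
Proof.
move=> uv uw vw lu lv lw Eh fuw fvw a avl.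
have hv : v \notin Ess h by rewrite Eh !inE eqxx.
have hw : w \notin Ess h by rewrite Eh !inE eqxx orbT.
have hess t : t <> v -> t <> w -> ~ (t \notin Ess h).
  by move=> /eqP/negPf tv /eqP/negPf tw; rewrite Eh !inE tv tw.
have [//|t tv ft] := @loses v l; first by congruence.
have [tw|tw] := eqVneq t w.
  subst t; rewrite (ft a (update a w (a u))); first last.
  - by move=> m; pointwise.
  - by pointwise.
  - by [].
  rewrite fuw; last by pointwise.
  by apply: (inessential2_eq hv hw) => m; pointwise.
case: (hess t) => //; first exact/eqP.
apply/essentialPn => b c bc.
(* The value of [h] is read off from [f] at [e b], where [v] equals [l] and [w] equals [v] or [u].
   The partner of [w] is chosen so that [w] does not move when [t] does; for [t = l] only [v] moves
   along. *)
have [tu|/eqP tu] := eqVneq t u.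
  pose e b := update (update b v (b l)) w (b l).
  have he d : h d = f (e d).
    rewrite fvw; last by rewrite /e; pointwise.
    by apply: (inessential2_eq hv hw) => m; rewrite /e; pointwise.
  rewrite !he; apply: ft; rewrite /e; try by pointwise.
  move=> m mt mv; rewrite !ffunE; case: eqP => _.
    by apply: bc; congruence.
  by case: eqP => // _; apply: bc.
pose e b := update (update b v (b l)) w (b u).
have he d : h d = f (e d).
  rewrite fuw; last by rewrite /e; pointwise.
  by apply: (inessential2_eq hv hw) => m; rewrite /e; pointwise.
rewrite !he; apply: ft; rewrite /e; try by pointwise.
move=> m mt mv; rewrite !ffunE; case: eqP => _.
  by apply: bc; congruence.
by case: eqP => // _; apply: bc.
Qed.

Lemma agree_all h (u v w : 'I_n) :
  u <> v -> u <> w -> v <> w ->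
  Ess h = ~: [set v; w] ->
  (forall a, a u = a v -> f a = h a) ->
  (forall a, a u = a w -> f a = h a) ->
  (forall a, a v = a w -> f a = h a) ->
  forall p q a, p <> q -> a p = a q -> f a = h a.
Proof.
move=> uv uw vw Eh fuv fuw fvw.
have hv : v \notin Ess h by rewrite Eh !inE eqxx.
have hw : w \notin Ess h by rewrite Eh !inE eqxx orbT.
have fv l a : l <> v -> a v = a l -> f a = h a.
  have [->|/eqP lu] := eqVneq l u; first by move=> _ E; exact: fuv.
  have [->|/eqP lw] := eqVneq l w; first by move=> _; exact: fvw.
  by move=> lv; apply: (@agree_pair h u v w).
have fw l a : l <> w -> a w = a l -> f a = h a.
  have [->|/eqP lu] := eqVneq l u; first by move=> _ E; exact: fuw.
  have [->|/eqP lv] := eqVneq l v; first by move=> _ E; exact: fvw.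
  move=> lw; apply: (@agree_pair h u w v) => //; try congruence.
    by rewrite setUC.
  by move=> b E; exact: fvw.
move=> p q a pq apq.
have [E|/eqP pv] := eqVneq p v.
  by subst p; apply: (fv q) => //; congruence.
have [E|/eqP qv] := eqVneq q v.
  by subst q; apply: (fv p).
have [E|/eqP pw] := eqVneq p w.
  by subst p; apply: (fw q) => //; congruence.
have [E|/eqP qw] := eqVneq q w.
  by subst q; apply: (fw p).
have [//|t tp ft] := @loses p q.
have [E|/eqP tv] := eqVneq t v.
  subst t; rewrite (ft a (update a v (a w))) //; try by [pointwise | move=> m; pointwise].
  rewrite fvw; last by pointwise.
  by apply: (inessential2_eq hv hw) => m; pointwise.
have [E|/eqP tw] := eqVneq t w.
  subst t; rewrite (ft a (update a w (a v))) //; try by [pointwise | move=> m; pointwise].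
  rewrite fvw; last by pointwise.
  by apply: (inessential2_eq hv hw) => m; pointwise.
pose c := a v.
(* The lost entry [t] is set to [a v]; for [t = q] entry [p] follows, which keeps [p] and [q]
   equal. *)
pose move_t b := if t == q then update (update b q c) p c else update b t c.
have move_pq b : b p = b q -> move_t b p = move_t b q.
  by rewrite /move_t; case: eqP => tq bpq; pointwise.
have f_move b : b p = b q -> f b = f (move_t b).
  move=> bpq; apply: ft => //; first exact: move_pq.
  by move=> m mt mp; rewrite /move_t; case: eqP => tq; pointwise.
(* After the move, entries [t] and [v] coincide, so [f] is [h] there. To return to [a], the entry
   [w], ignored by [h], is set to [a v]: agreement then holds both before and after the move, and
   [f] is unchanged by it. *)
rewrite f_move // (fv t) //; last first.
  by rewrite /move_t; case: eqP => tq; rewrite /c; pointwise.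
pose a' := update a w (a v).
have aa' : h a = h a' by apply: (inessential2_eq hv hw) => m; rewrite /a'; pointwise.
have maa' : h (move_t a) = h (move_t a').
  apply: (inessential2_eq hv hw) => m.
  by rewrite /move_t /a'; case: eqP => tq; pointwise.
have a'pq : a' p = a' q by rewrite /a'; pointwise.
rewrite aa' maa' -(fvw a'); last by rewrite /a'; pointwise.
rewrite f_move //; symmetry; apply: fvw.
by rewrite /move_t /a'; case: eqP => tq; pointwise.
Qed.

Lemma minor_dichotomy h (i j m d : 'I_n) :
  i <> j -> i <> m -> j <> m -> d <> i -> d <> j -> d <> m ->
  Ess h = ~: [set i; m] ->
  (forall a, a i = a j -> f a = h a) ->
  ((forall a, a i = a m -> f a = h a) /\ (forall a, a j = a m -> f a = h a)) \/
  ((forall a, a i = a m -> f a = h (update a j (a i))) /\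
   (forall a, a j = a m -> f a = h (update a j (a i)))).
Proof.
move=> ij im jm di dj dm Eh fij.
have hi : i \notin Ess h by rewrite Eh !inE eqxx.
have hm : m \notin Ess h by rewrite Eh !inE eqxx orbT.
have hess t : t <> i -> t <> m -> ~ (t \notin Ess h).
  by move=> /eqP/negPf ti /eqP/negPf tm; rewrite Eh !inE ti tm.
have hE a b : (forall l, l <> i -> l <> m -> a l = b l) -> h a = h b.
  exact: inessential2_eq hi hm.
(* All of [h] is visible on tuples with entries [i], [j], [m] equal, so no variable outside these
   three can be lost there. *)
have diag t : (forall a b, a i = a j -> a m = a j -> b i = b j -> b m = b j ->
    (forall l, l <> t -> a l = b l) -> f a = f b) ->
    t <> i -> t <> j -> t <> m -> False.
  move=> ft ti tj tm; apply: (hess t) => //; apply/essentialPn => b c bc.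
  pose e b := update (update b i (b j)) m (b j).
  have he x : h x = f (e x).
    rewrite fij; last by rewrite /e; pointwise.
    by apply: hE => l; rewrite /e; pointwise.
  rewrite !he; apply: ft; rewrite /e; try by pointwise.
  move=> l lt; rewrite !ffunE (bc j); last by congruence.
  by rewrite (bc l).
(* Losing [i] lets the common value of [i] and [m] be set to [a j], so [h] is read in [j]; losing
   [j] lets [a j] be set to [a i], so [h] is read in [i]. *)
have im_cases : (forall a, a i = a m -> f a = h a) \/
                (forall a, a i = a m -> f a = h (update a j (a i))).
  have [|t tm ft] := @loses m i; first by congruence.
  have [E|/eqP ti] := eqVneq t i.
    left=> a aim; rewrite (ft a (update (update a i (a j)) m (a j))) //.
    - rewrite fij; last by pointwise.
      by apply: hE => l; pointwise.
    - by pointwise.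
    - by move=> l; pointwise.
  have [E|/eqP tj] := eqVneq t j.
    right=> a aim; rewrite (ft a (update a j (a i))) //.
    - by rewrite fij //; pointwise.
    - by pointwise.
    - by move=> l; pointwise.
  exfalso; apply: (diag t) => // a b ai am bi bm ab.
  by apply: ft => //; congruence || (move=> l *; apply: ab).
have jm_cases : (forall a, a j = a m -> f a = h a) \/
                (forall a, a j = a m -> f a = h (update a j (a i))).
  have [|t tm ft] := @loses m j; first by congruence.
  have [E|/eqP ti] := eqVneq t i.
    left=> a ajm; rewrite (ft a (update a i (a j))) //.
    - rewrite fij; last by pointwise.
      by apply: hE => l; pointwise.
    - by pointwise.
    - by move=> l; pointwise.
  have [E|/eqP tj] := eqVneq t j.
    right=> a ajm; rewrite (ft a (update (update a j (a i)) m (a i))) //.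
    - rewrite fij; last by pointwise.
      by apply: hE => l; pointwise.
    - by pointwise.
    - by move=> l; pointwise.
  exfalso; apply: (diag t) => // a b ai am bi bm ab.
  by apply: ft => //; congruence || (move=> l *; apply: ab).
case: im_cases jm_cases => A [] B.
- by left.
(* Here both [f(x,y,x)] and [f(y,x,x)] read the odd entry [y]. Identifying [d] with [i] makes [d]
   inessential in [h] if [t = i], [j] if [t] is [j] or [m], and [t] itself otherwise. *)
- exfalso; have [//|t td ft] := @loses d i.
  pose e b := update (update b i (b d)) m (b d).
  have he b : h b = f (e b).
    rewrite A; last by rewrite /e; pointwise.
    by apply: hE => l; rewrite /e; pointwise.
  have [E|/eqP ti] := eqVneq t i.
    apply: (hess d) => //; apply: (@inessential_of_identify _ _ _ _ j) => // b.
    rewrite he (ft _ (update (update (e b) i (b j)) d (b j))); rewrite /e.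
    + rewrite fij; last by pointwise.
      by apply: hE => l; pointwise.
    + by pointwise.
    + by pointwise.
    + by move=> l; pointwise.
  have [E|/eqP tj] := eqVneq t j.
    apply: (hess j) => //; try congruence.
    apply: (@inessential_of_identify _ _ _ _ d) => [|b]; first by congruence.
    rewrite he (ft _ (update (e b) j (b d))); rewrite /e.
    + rewrite fij; last by pointwise.
      by apply: hE => l; pointwise.
    + by pointwise.
    + by pointwise.
    + by move=> l; pointwise.
  have [E|/eqP tm] := eqVneq t m.
    apply: (hess j) => //; try congruence.
    apply: (@inessential_of_identify _ _ _ _ d) => [|b]; first by congruence.
    rewrite he (ft _ (update (e b) m (b j))); rewrite /e.
    + rewrite B; last by pointwise.
      by apply: hE => l; pointwise.
    + by pointwise.
    + by pointwise.
    + by move=> l; pointwise.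
  apply: (hess t) => //; apply/essentialPn => b c bc.
  rewrite !he; apply: ft; rewrite /e; try by pointwise.
  move=> l lt ld; rewrite !ffunE (bc d); last by congruence.
  by rewrite (bc l).
(* The majority pattern. Now [m] is tied to [j], leaving [i] free to equal [d]; the same variables
   become inessential in each case. *)
- exfalso; have [//|t td ft] := @loses d i.
  pose e b := update (update b i (b d)) m (b j).
  have he b : h b = f (e b).
    rewrite B; last by rewrite /e; pointwise.
    by apply: hE => l; rewrite /e; pointwise.
  have [E|/eqP ti] := eqVneq t i.
    apply: (hess d) => //; apply/essentialPn => b c bc.
    rewrite !he; apply: ft; rewrite /e; try by pointwise.
    move=> l lt ld; rewrite !ffunE (bc j); last by congruence.
    rewrite (bc l) //; case: eqP => // _; case: eqP => //; congruence.
  have [E|/eqP tj] := eqVneq t j.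
    apply: (hess j) => //; try congruence.
    apply: (@inessential_of_identify _ _ _ _ d) => [|b]; first by congruence.
    rewrite he (ft _ (update (e b) j (b d))); rewrite /e.
    + rewrite fij; last by pointwise.
      by apply: hE => l; pointwise.
    + by pointwise.
    + by pointwise.
    + by move=> l; pointwise.
  have [E|/eqP tm] := eqVneq t m.
    apply: (hess j) => //; try congruence.
    apply: (@inessential_of_identify _ _ _ _ d) => [|b]; first by congruence.
    rewrite he (ft _ (update (e b) m (b d))); rewrite /e.
    + rewrite A; last by pointwise.
      by apply: hE => l; pointwise.
    + by pointwise.
    + by pointwise.
    + by move=> l; pointwise.
  apply: (hess t) => //; apply/essentialPn => b c bc.
  rewrite !he; apply: ft; rewrite /e; try by pointwise.
  move=> l lt ld; rewrite !ffunE (bc d); last by congruence.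
  by rewrite (bc l) // (bc j) //; congruence.
- by right.
Qed.

End Decomposition.

(** * The two implications *)

Lemma agree_gap2 (k n : nat) (f : Pkn k n) :
  (3 < n)%N -> Ess f = [set: 'I_n] -> f \in Gplus k n 2 ->
  exists h : Pkn k n, ess h = (n - 2)%N /\
    forall p q (a : {ffun 'I_n -> 'Z_k}), p <> q -> a p = a q -> f a = h a.
Proof.
move=> hn fT; have n1 : (1 < n)%N by rewrite (leq_trans _ hn).
rewrite inE => /andP []; rewrite inE => /andP [_ /eqP f2].
case/existsP => i /existsP [j /and3P [ij ej /eqP en]].
have loses u v := @identify_loses _ _ f u v n1 fT f2.
set h := identify f i j in ej en.
have hi : i \notin Ess h by exact: identify_notin_Ess.
have cC : #|~: Ess h| = 2%N.
  by have := cardsC (Ess h); rewrite -/(ess h) en card_ord => E;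
     apply/eqP; rewrite -(eqn_add2l (n - 2)) E subnK.
have [m mi Cm] : exists2 m, m != i & ~: Ess h = [set i; m].
  have iC : i \in ~: Ess h by rewrite inE.
  have /eqP := cC; rewrite (cardsD1 i) iC eqSS => /cards1P [m Em].
  exists m; first by have := set11 m; rewrite -Em !inE => /andP [].
  by rewrite -(setD1K iC) Em.
have Eh : Ess h = ~: [set i; m] by rewrite -Cm setCK.
(* The condition defining [Gplus] beyond the gap enters here: [j] survives, so the second lost
   variable [m] is a third one. The fourth variable [d] exists because [3 < n]. *)
have jm : j != m by move: ej; rewrite Eh !inE negb_or => /andP [].
have [d] : exists d, d \in ~: [set i; j; m].
  apply/card_gt0P; rewrite cardsCs setCK card_ord subn_gt0.
  apply: leq_ltn_trans hn; rewrite -setUA !cardsU1 cards1.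
  by do 2!case: (_ \notin _).
rewrite !inE !negb_or -andbA => /and3P [/eqP di /eqP dj /eqP dm].
move/eqP: ij => ij; move/eqP: jm => jm; move/eqP: mi => mi.
have im : i <> m by congruence.
have fij (a : {ffun 'I_n -> 'Z_k}) : a i = a j -> f a = h a by move=> E; rewrite identifyE.
have [[A B]|[A B]] := minor_dichotomy loses ij im jm di dj dm Eh fij.
  exists h; split=> //.
  apply: (agree_all loses (u := j) (v := i) (w := m)) => //; first by congruence.
  by move=> a E; apply: fij.
(* In the remaining case [f] reads [h] in [i], so the opposite minor is the witness; its essential
   set is that of [h] with [i] and [j] exchanged. *)
pose h' := identify f j i.
have hh' a : h' a = h (update a j (a i)).
  rewrite /h identifyE; first by rewrite ffunE.
  by pointwise.
have Eh' : Ess h' = ~: [set j; m].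
  apply/setP => l; rewrite identify_swap_Ess -/h Eh !inE; congr (~~ (_ || _)).
    by rewrite (canF_eq (tpermK i j)) tpermL.
  by rewrite (canF_eq (tpermK i j)) tpermD //; apply/eqP.
exists h'; split.
  by rewrite -en /ess Eh' Eh [LHS]cardsCs [RHS]cardsCs !setCK !cards2;
     move/eqP: im => ->; move/eqP: jm => ->.
apply: (agree_all loses (u := i) (v := j) (w := m)) => //.
- by move=> a E; rewrite fij // hh'; congr (h _); apply/ffunP => l; pointwise.
- by move=> a E; rewrite hh' A.
- by move=> a E; rewrite hh' B.
Qed.

(** The minors of [f] are those of [h], so none exceeds [n - 2] essential variables. Replacing a
    variable inessential in [h] by an essential one returns [h], which attains the bound. *)
Lemma gap2_of_decomposition (k n : nat) (f h g : Pkn k n) :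
  (2 < n)%N -> Ess f = [set: 'I_n] -> ess h = (n - 2)%N -> f = h + g ->
  (forall i j : 'I_n, i != j -> identify g i j = 0) -> f \in Gplus k n 2.
Proof.
move=> n2 fT hn fE g0.
have fn : ess f = n by rewrite /ess fT cardsT card_ord.
have fh i j : i != j -> identify f i j = identify h i j.
  move=> ij; apply/ffunP => a; have /ffunP/(_ a) := g0 _ _ ij.
  by rewrite fE !ffunE => ->; rewrite addr0.
have [i hi] : exists i, i \in ~: Ess h.
  apply/card_gt0P; rewrite cardsCs setCK card_ord -/(ess h) hn subKn //.
  exact: ltnW.
have [j hj] : exists j, j \in Ess h.
  by apply/card_gt0P; rewrite -/(ess h) hn subn_gt0.
rewrite inE in hi.
have ij : i != j by apply: contraNneq hi => ->.
have fhij : identify f i j = h by rewrite fh // identify_inessential.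
have maxE : (\max_(t in Min f) ess t)%N = (n - 2)%N.
  apply/eqP; rewrite eqn_leq; apply/andP; split.
    apply/bigmax_leqP => t /imset2P [u v _]; rewrite inE => /andP [_ uv] ->.
    by rewrite fh // -hn ess_identify_le.
  have := identify_inMin fT ij; rewrite fhij => hM.
  by rewrite -hn; apply: (@leq_bigmax_cond _ _ (fun t => ess t) h hM).
rewrite !inE fn eqxx /gap fn maxE subKn ?(ltnW n2) //=.
by apply/existsP; exists i; apply/existsP; exists j; rewrite ij fhij hj hn eqxx.
Qed.

Theorem theorem4p6 (k n : nat) (hk : (3 <= k)%N) (hn : (3 < n)%N)
    (f : Pkn k n) (hf : Ess f = [set: 'I_n]) :
  f \in Gplus k n 2
  <->
  exists (Y : {set 'I_n}) (h g : Pkn k n),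
    [/\ #|Y| = (n - 2)%N,
        f = h + g,
        Ess h = Y,
        g \in G k n n n
      & forall i j : 'I_n, i != j -> identify g i j = 0].
Proof.
split=> [fG|[Y [h [g [Yn fE hY _ g0]]]]]; last first.
  by apply: gap2_of_decomposition fE g0; rewrite ?(ltnW hn) // /ess hY.
have n1 : (1 < n)%N by rewrite (leq_trans _ hn).
have [h [hn2 fh]] := agree_gap2 hn hf fG.
have g0 i j : i != j -> identify (f - h) i j = 0.
  move=> /eqP ij; apply/ffunP => a; rewrite !ffunE (fh i j) ?subrr //.
  by pointwise.
exists (Ess h), h, (f - h); split=> //; first by rewrite addrC subrK.
apply: vanishing_inG => //; apply: vanishing_Ess => //.
(* The remainder is nonzero, since [f = h] would force [n = n - 2]. *)
rewrite subr_eq0; apply: contra_eq_neq hn2 => <-.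
by rewrite /ess hf cardsT card_ord neq_ltn ltn_subrL (ltnW n1) orbT.
Qed.
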